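(* Let $k\ge0$ be fixed, and let $S\subset\mathfrak a_{\mathbb C}\times\mathfrak a_{\mathbb C}$ be a non-empty compact subset. Then, as $\epsilon\to0$ through the (nonzero) complex numbers, $$\lim_{\epsilon\to0}C_G(\epsilon^{-1}\lambda,k,\epsilon z)=\mathrm{Exp}_G(\lambda,k,z),$$ uniformly for $(\lambda,z)\in S$. Here it is understood that $|\epsilon|$ is taken sufficiently small, so that $C_G(\epsilon^{-1}\lambda,k,\epsilon z)$ is defined for all $(\lambda,z)\in S$.
   Context: Let $\mathfrak a$ be a finite-dimensional real inner product space with inner product $(\cdot,\cdot)$, extended complex-bilinearly to $\mathfrak a_{\mathbb C}=\mathfrak a\otimes_{\mathbb R}\mathbb C$. Let $R\subset\mathfrak a$ be a reduced integral (crystallographic) root system with Weyl group $G$, positive system $R_+$, and reflections $s_\alpha$. A multiplicity function is a $G$-invariant function $k$ on $R$; $k\ge0$ means that all values $k_\alpha$ are real and non-negative. Let $\rho(k)=\frac12\sum_{\alpha\in R_+}k_\alpha\alpha$. Cherednik operators: for $\xi\in\mathfrak a_{\mathbb C}$, $$D_\xi(k)f(x)=\partial_\xi f(x)+\sum_{\alpha\in R_+}k_\alpha(\alpha,\xi)\frac{f(x)-f(s_\alpha x)}{1-e^{-(\alpha,x)}}-(\rho(k),\xi)f(x).$$ Known result (Opdam), defining $C_G$: for every $k\ge0$ there are an open neighborhood $U$ of $0$ in $\mathfrak a$ and a holomorphic function $C_G(\cdot,k,\cdot):\mathfrak a_{\mathbb C}\times(\mathfrak a+iU)\to\mathbb C$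 such that: (1) $C_G(\lambda,k,0)=1$ for all $\lambda\in\mathfrak a_{\mathbb C}$; (2) $D_\xi(k)C_G(\lambda,k,\cdot)=(\lambda,\xi)C_G(\lambda,k,\cdot)$ for all $\lambda,\xi\in\mathfrak a_{\mathbb C}$; (3) for $\lambda\in\mathfrak a_{\mathbb C}$ and $z=x+iy$ with $x\in\mathfrak a$, $y\in U$, $$|C_G(\lambda,k,z)|\le\sqrt{|G|}\,e^{-\min_{g\in G}(g\,\mathrm{Im}\lambda,y)+\max_{g\in G}(g\rho(k),y)+\max_{g\in G}(g\,\mathrm{Re}\lambda,x)}.$$ The function $C_G$ in the claim is this function. Dunkl kernel: the Dunkl operators are $T_\xi(k)f(x)=\partial_\xi f(x)+\sum_{\alpha\in R_+}k_\alpha(\alpha,\xi)\frac{f(x)-f(s_\alpha x)}{(\alpha,x)}$ (they do not depend on the lengths of the roots). For $k\ge0$ and $\lambda\in\mathfrak a_{\mathbb C}$, $\mathrm{Exp}_G(\lambda,k,\cdot)$ is the unique holomorphic function $f$ on $\mathfrak a_{\mathbb C}$ with $T_\xi(k)f=(\lambda,\xi)f$ for all $\xi\in\mathfrak a$ and $f(0)=1$; the local solution space of this eigenvalue system around $0$ is one-dimensional, and $\mathrm{Exp}_G(\lambda,k,z)$ is holomorphic in $(\lambda,z)$. *)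

(* Defs.v *)
From HB Require Import structures.
From mathcomp Require Import all_boot all_order all_algebra.
From mathcomp Require Import finmap complex.
From mathcomp Require Import all_classical all_reals all_analysis.

Set Implicit Arguments.
Unset Strict Implicit.
Unset Printing Implicit Defensive.

Import Order.TTheory GRing.Theory Num.Theory.
Import numFieldNormedType.Exports.

Local Open Scope classical_set_scope.
Local Open Scope complex_scope.
Local Open Scope ring_scope.

(* [numFieldNormedType.Exports] only covers abstract number fields, so the
   standard topology of the regular module R[i]^o is copied onto R[i]. *)
HB.instance Definition _ (R : realType) := PseudoPointedMetric.copy R[i] R[i]^o.
HB.instance Definition _ (R : realType) := GRing.ComAlgebra.copy R[i] R[i]^o.
HB.instance Definition _ (R : realType) := Vector.copy R[i] R[i]^o.
HB.instance Definition _ (R : realType) := NormedModule.copy R[i] R[i]^o.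

(* The real inner product space a is R^n with an arbitrary inner product
   [ip : {dot 'rV[R]_n for idfun}]; its complexification a_C is 'rV[R[i]]_n,
   with real and imaginary parts taken coordinatewise. *)

Definition vecRe (R : realType) (n : nat) (z : 'rV[R[i]]_n) : 'rV[R]_n :=
  map_mx (@complex.Re R) z.

Definition vecIm (R : realType) (n : nat) (z : 'rV[R[i]]_n) : 'rV[R]_n :=
  map_mx (@complex.Im R) z.

Definition vecC (R : realType) (n : nat) (x : 'rV[R]_n) : 'rV[R[i]]_n :=
  map_mx (real_complex R) x.

(* Complex-bilinear (not sesquilinear) extension of the inner product. *)
Definition ipC (R : realType) (n : nat) (ip : {dot 'rV[R]_n for idfun})
    (z w : 'rV[R[i]]_n) : R[i] :=
  (ip (vecRe z) (vecRe w) - ip (vecIm z) (vecIm w)) +i*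
  (ip (vecRe z) (vecIm w) + ip (vecIm z) (vecRe w)).

Definition cexp (R : realType) (z : R[i]) : R[i] :=
  (expR (complex.Re z))%:C * (cos (complex.Im z) +i* sin (complex.Im z)).

(* Meant for open D. *)
Definition holomorphic_on (R : realType) (V : normedModType R[i]) (D : set V)
    (f : V -> R[i]) : Prop :=
  forall z, D z -> differentiable f z.

Definition reflection (R : realType) (n : nat) (ip : {dot 'rV[R]_n for idfun})
    (a x : 'rV[R]_n) : 'rV[R]_n :=
  x - (2 * ip x a / ip a a) *: a.

Definition reflectionC (R : realType) (n : nat) (ip : {dot 'rV[R]_n for idfun})
    (a : 'rV[R]_n) (z : 'rV[R[i]]_n) : 'rV[R[i]]_n :=
  z - (2 * ipC ip z (vecC a) / (ip a a)%:C) *: vecC a.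

(* Reduced and integral; the roots are not required to span the space. *)
Record root_system (R : realType) (n : nat) (ip : {dot 'rV[R]_n for idfun})
    (Rt : {fset 'rV[R]_n}) : Prop := RootSystem {
  root_neq0 : 0 \notin Rt;
  root_reflection : forall a b, a \in Rt -> b \in Rt ->
    reflection ip a b \in Rt;
  root_integral : forall a b, a \in Rt -> b \in Rt ->
    2 * ip b a / ip a a \is a Num.int;
  root_reduced : forall a (c : R), a \in Rt -> c *: a \in Rt ->
    c = 1 \/ c = - 1
}.

Definition positive_system (R : realType) (n : nat)
    (ip : {dot 'rV[R]_n for idfun}) (Rt Rp : {fset 'rV[R]_n}) : Prop :=
  exists v : 'rV[R]_n, (forall a, a \in Rt -> ip a v != 0) /\
    (forall a, (a \in Rp) = (a \in Rt) && (0 < ip a v)).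

(* Reflections are involutions, so the monoid they generate is a group. *)
Inductive in_weyl_group (R : realType) (n : nat)
    (ip : {dot 'rV[R]_n for idfun}) (Rt : {fset 'rV[R]_n}) :
    ('rV[R]_n -> 'rV[R]_n) -> Prop :=
| weyl_id : in_weyl_group ip Rt id
| weyl_reflection a g : a \in Rt -> in_weyl_group ip Rt g ->
    in_weyl_group ip Rt (reflection ip a \o g).

(* [fset_set] enumerates a finite set (and would be empty on an infinite one);
   the Weyl group of a root system is finite. *)
Definition weyl_group (R : realType) (n : nat) (ip : {dot 'rV[R]_n for idfun})
    (Rt : {fset 'rV[R]_n}) : {fset ('rV[R]_n -> 'rV[R]_n)} :=
  fset_set [set g | in_weyl_group ip Rt g].

(* max_g (g x, y) and min_g (g x, y) over the Weyl group; the initial value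
   [ip x y] of the iteration is the term of the identity. *)
Definition weyl_max (R : realType) (n : nat) (ip : {dot 'rV[R]_n for idfun})
    (Rt : {fset 'rV[R]_n}) (x y : 'rV[R]_n) : R :=
  \big[Num.max/ip x y]_(g <- weyl_group ip Rt) ip (g x) y.

Definition weyl_min (R : realType) (n : nat) (ip : {dot 'rV[R]_n for idfun})
    (Rt : {fset 'rV[R]_n}) (x y : 'rV[R]_n) : R :=
  \big[Num.min/ip x y]_(g <- weyl_group ip Rt) ip (g x) y.

(* A function on the roots is the restriction of a function on the space;
   values outside of the roots are irrelevant. *)
Definition multiplicity_function (R : realType) (n : nat)
    (ip : {dot 'rV[R]_n for idfun}) (Rt : {fset 'rV[R]_n})
    (k : 'rV[R]_n -> R) : Prop :=
  forall g a, in_weyl_group ip Rt g -> a \in Rt -> k (g a) = k a.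

Definition rho (R : realType) (n : nat) (Rp : {fset 'rV[R]_n})
    (k : 'rV[R]_n -> R) : 'rV[R]_n :=
  2^-1 *: \sum_(a <- Rp) k a *: a.

(* [cherednik_op] and [dunkl_op] are only meaningful where the denominators do
   not vanish. For holomorphic f the singularities along the hyperplanes
   (a, z) = 0 are removable, so an eigenvalue equation holds with the
   continuous extension iff it holds off the zeros of the denominators. *)
Definition cherednik_op (R : realType) (n : nat)
    (ip : {dot 'rV[R]_n for idfun}) (Rp : {fset 'rV[R]_n})
    (k : 'rV[R]_n -> R) (xi : 'rV[R[i]]_n)
    (f : 'rV[R[i]]_n -> R[i]) (z : 'rV[R[i]]_n) : R[i] :=
  'D_xi f z
  + \sum_(a <- Rp) (k a)%:C * ipC ip (vecC a) xi *
      ((f z - f (reflectionC ip a z)) / (1 - cexp (- ipC ip (vecC a) z)))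
  - ipC ip (vecC (rho Rp k)) xi * f z.

Definition dunkl_op (R : realType) (n : nat)
    (ip : {dot 'rV[R]_n for idfun}) (Rp : {fset 'rV[R]_n})
    (k : 'rV[R]_n -> R) (xi : 'rV[R[i]]_n)
    (f : 'rV[R[i]]_n -> R[i]) (z : 'rV[R[i]]_n) : R[i] :=
  'D_xi f z
  + \sum_(a <- Rp) (k a)%:C * ipC ip (vecC a) xi *
      ((f z - f (reflectionC ip a z)) / ipC ip (vecC a) z).

(* The tube a + iU. *)
Definition tube (R : realType) (n : nat) (U : set 'rV[R]_n) :
    set 'rV[R[i]]_n :=
  [set z | U (vecIm z)].

(* Opdam's function C_G, given by its defining properties; only its values on
   a_C x (a + iU) matter. The eigenvalue equation is required at the points
   where each of its terms makes sense. *)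
Record is_C_G (R : realType) (n : nat) (ip : {dot 'rV[R]_n for idfun})
    (Rt Rp : {fset 'rV[R]_n}) (k : 'rV[R]_n -> R) (U : set 'rV[R]_n)
    (C : 'rV[R[i]]_n -> 'rV[R[i]]_n -> R[i]) : Prop := IsCG {
  C_G_open : open U;
  C_G_nbhs0 : U 0;
  C_G_holomorphic :
    holomorphic_on [set p : 'rV[R[i]]_n * 'rV[R[i]]_n | tube U p.2]
      (fun p => C p.1 p.2);
  C_G_at0 : forall lambda, C lambda 0 = 1;
  C_G_eigen : forall lambda xi z, tube U z ->
    (forall a, a \in Rp -> tube U (reflectionC ip a z)) ->
    (forall a, a \in Rp -> 1 - cexp (- ipC ip (vecC a) z) != 0) ->
    cherednik_op ip Rp k xi (C lambda) z = ipC ip lambda xi * C lambda z;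
  C_G_bound : forall lambda z, tube U z ->
    `|C lambda z| <=
      (Num.sqrt (#|` weyl_group ip Rt|%:R) *
       expR (- weyl_min ip Rt (vecIm lambda) (vecIm z)
             + weyl_max ip Rt (rho Rp k) (vecIm z)
             + weyl_max ip Rt (vecRe lambda) (vecRe z)))%:C
}.

(* f is the Dunkl kernel Exp_G(lambda, k, .). *)
Record is_Exp_G (R : realType) (n : nat) (ip : {dot 'rV[R]_n for idfun})
    (Rp : {fset 'rV[R]_n}) (k : 'rV[R]_n -> R) (lambda : 'rV[R[i]]_n)
    (f : 'rV[R[i]]_n -> R[i]) : Prop := IsExpG {
  Exp_G_holomorphic : holomorphic_on setT f;
  Exp_G_eigen : forall (xi : 'rV[R]_n) (z : 'rV[R[i]]_n),
    (forall a, a \in Rp -> ipC ip (vecC a) z != 0) ->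
    dunkl_op ip Rp k (vecC xi) f z = ipC ip lambda (vecC xi) * f z;
  Exp_G_at0 : f 0 = 1
}.

(* Main.v *)
Require Import Defs.
From HB Require Import structures.
From mathcomp Require Import all_boot all_order all_algebra.
From mathcomp Require Import finmap complex.
From mathcomp Require Import all_classical all_reals all_analysis.
From mathcomp Require Import ring lra.

(* Fix z off the root hyperplanes. Along the Weyl orbit of z, the functions
   u_g(t) = C_G(lambda/eps, eps t g z) and v_g(t) = Exp_G(lambda, t g z) of t in
   [0,1] satisfy (take the direction xi = g z in the eigenvalue equations)
     t u_g' = - sum_a k_a (1 + O(eps t)) (u_g - u_(s_a g))
              + t ((lambda, g z) + O(eps)) u_g,
     t v_g' = - sum_a k_a (v_g - v_(s_a g)) + t (lambda, g z) v_g.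
   As k >= 0, the singular term is dissipative for the energy
   V = sum_g |u_g - v_g|^2, because s_a permutes the orbit:
     2 sum_g <d_g, d_g - d_(s_a g)> = sum_g |d_g - d_(s_a g)|^2.
   Gronwall's inequality bounds u, then gives u - v = O(eps), with constants
   depending only on bounds for lambda and z. Singular z follow by continuity. *)

Set Implicit Arguments.
Unset Strict Implicit.
Unset Printing Implicit Defensive.

Import Order.TTheory GRing.Theory Num.Theory.
Import numFieldNormedType.Exports.

Local Open Scope classical_set_scope.
Local Open Scope complex_scope.
Local Open Scope ring_scope.

Local Notation cabs := ComplexField.Normc.normc.

(** * Energy estimate for real systems with a reflection singularity at [t = 0] *)

(** The singular term can only decrease the energy, the sum of the [u i t ^+ 2], because pairing [i]
    with [sigma a i] turns its contribution into minus a sum of squares. Hence neither the factor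
    [1/t] nor the size of [k] enters the bound. *)
Lemma orbit_gronwall (R : realType) (I : finType) (J : eqType) (s : seq J)
    (k : J -> R) (sigma : J -> I -> I) (u du r : I -> R -> R) (L H : R) :
  (forall a, a \in s -> 0 <= k a) ->
  (forall a, a \in s -> involutive (sigma a)) ->
  0 <= L -> 0 <= H ->
  (forall i (t : R), 0 <= t <= 1 -> is_derive t (1 : R) (u i) (du i t)) ->
  (forall i (t : R), 0 < t <= 1 ->
     t * du i t = - (\sum_(a <- s) k a * (u i t - u (sigma a i) t))
                  + t * r i t) ->
  (forall t : R, 0 < t <= 1 ->
     \sum_i r i t ^+ 2 <= L * (\sum_i u i t ^+ 2) + H) ->
  forall t : R, 0 <= t <= 1 ->
    \sum_i u i t ^+ 2 <= (\sum_i u i 0 ^+ 2 + H) * expR (1 + L).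
Proof.
move=> k0 sigmaK L0 H0 hdu ode hr.
pose V (t : R) := \sum_i u i t ^+ 2.
pose dV (t : R) := \sum_i 2 * u i t * du i t.
have V_ge0 (t : R) : 0 <= V t by apply: sumr_ge0 => i _; exact: sqr_ge0.
have derV (t : R) : 0 <= t <= 1 -> is_derive t (1 : R) V (dV t).
  move=> t01; rewrite /V /dV.
  have -> : (fun t : R => \sum_i u i t ^+ 2) = \sum_i (fun t : R => u i t ^+ 2).
    by apply/funext => x; rewrite fct_sumE.
  elim/big_ind2: _ => [|f df g dg hf hg|i _]; [exact: is_derive_cst|exact: is_deriveD|].
  have hi := hdu i t t01.
  have : is_derive t (1 : R) (u i ^+ 2) (2 * u i t * du i t).
    by apply: is_derive_eq; rewrite expr1.
  by [].
have dV_le (t : R) : 0 < t <= 1 -> dV t <= (1 + L) * V t + H.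
  move=> /[dup] t01 /andP[t0 _].
  have -> : dV t = t^-1 * \sum_i 2 * u i t * (t * du i t).
    rewrite /dV mulr_sumr; apply: eq_bigr => i _.
    by field; rewrite gt_eqF.
  have dissip : 0 <= \sum_i u i t * \sum_(a <- s) k a * (u i t - u (sigma a i) t).
    under eq_bigr do rewrite mulr_sumr.
    rewrite exchange_big /= big_seq; apply: sumr_ge0 => a sa.
    have -> : \sum_i u i t * (k a * (u i t - u (sigma a i) t)) =
        k a * (\sum_i (u i t ^+ 2 - u i t * u (sigma a i) t)).
      by rewrite mulr_sumr; apply: eq_bigr => i _; ring.
    apply: mulr_ge0; first exact: k0.
    (* Expanding this square gives twice the wanted sum, since [sigma a] permutes the indices and so
       preserves the total energy. *)
    have : 0 <= \sum_i (u i t - u (sigma a i) t) ^+ 2.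
      by apply: sumr_ge0 => i _; exact: sqr_ge0.
    have e : \sum_i u (sigma a i) t ^+ 2 = \sum_i u i t ^+ 2.
      rewrite [RHS](reindex_inj (inv_inj (sigmaK _ sa))) //.
    have -> : \sum_i (u i t - u (sigma a i) t) ^+ 2 =
        2 * \sum_i (u i t ^+ 2 - u i t * u (sigma a i) t)
        + (\sum_i u (sigma a i) t ^+ 2 - \sum_i u i t ^+ 2).
      by rewrite mulr_sumr -sumrB -big_split; apply: eq_bigr => i _ /=; ring.
    by rewrite e subrr addr0 pmulr_rge0.
  rewrite ler_pdivrMl //.
  (* Writing [2 * u * r] as [u ^+ 2 + r ^+ 2 - (u - r) ^+ 2] replaces the mixed term by energies;
     this is the source of the [1] in [1 + L]. *)
  have -> : \sum_i 2 * u i t * (t * du i t) =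
     - (2 * \sum_i u i t * \sum_(a <- s) k a * (u i t - u (sigma a i) t))
     + t * \sum_i (u i t ^+ 2 + r i t ^+ 2 - (u i t - r i t) ^+ 2).
    rewrite !mulr_sumr -sumrN -big_split; apply: eq_bigr => i _ /=.
    by rewrite ode//; ring.
  rewrite -[leRHS]add0r; apply: lerD; first by rewrite oppr_le0 mulr_ge0.
  rewrite ler_pM2l// mulrDl mul1r -addrA.
  apply: (@le_trans _ _ (\sum_i (u i t ^+ 2 + r i t ^+ 2))).
    by apply: ler_sum => i _; rewrite gerBl sqr_ge0.
  by rewrite big_split /= lerD2l hr.
move=> t t01.
(* Integrating factor for [V' <= (1 + L) V + H]. The forcing becomes [H] times an exponential that
   is at most 1, so subtracting [H * t] makes [W] nonincreasing. *)
pose W := fun t : R => V t * expR (- ((1 + L) * t)) - H * t.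
have derW (x : R) : 0 <= x <= 1 -> is_derive x (1 : R) W
    ((dV x - (1 + L) * V x) * expR (- ((1 + L) * x)) - H).
  move=> x01; have := derV x x01 => dVx.
  rewrite /W; apply: is_derive_eq.
  by rewrite /GRing.scale /=; ring.
have Wle : W t <= W 0.
  apply: (@ler0_derive1_nincr R W 0 1) => //; try by case/andP: t01.
  - move=> x; rewrite in_itv /= => /andP[x0 x1].
    by have [|] := derW x; rewrite ?(ltW x0) ?(ltW x1).
  - move=> x; rewrite in_itv /= => /andP[x0 x1].
    have d := derW x; rewrite (ltW x0) (ltW x1) in d; have {}d := d isT.
    rewrite derive1E derive_val subr_le0.
    have := dV_le x; rewrite x0 (ltW x1) => /(_ isT) dVx.
    apply: (@le_trans _ _ (H * expR (- ((1 + L) * x)))).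
      by rewrite ler_pM2r ?expR_gt0// lerBlDl.
    rewrite ler_piMr// -[leRHS]expR0 ler_expR oppr_le0.
    by rewrite mulr_ge0 ?addr_ge0 ?(ltW x0).
  - apply: (@derivable_within_continuous R R^o W `[0, 1]) => x; rewrite in_itv /= => x01.
    by have [] := derW x x01.
case/andP: t01 => t0 t1.
move: Wle; rewrite /W !mulr0 oppr0 expR0 mulr1 addr0 lerBlDr => Wle.
have : V t <= (V 0 + H * t) * expR ((1 + L) * t).
  by rewrite -ler_pdivrMr ?expR_gt0// -expRN.
move=> /le_trans; apply; apply: ler_pM.
- by rewrite addr_ge0 ?mulr_ge0.
- exact: expR_ge0.
- by rewrite lerD2l ler_piMr.
- by rewrite ler_expR ler_piMr// addr_ge0.
Qed.

(** * The modulus of a complex number as an element of [R] *)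

Section ComplexModulus.
Context {R : realType}.
Implicit Types z w : R[i].

Lemma cabsE z : `|z| = (cabs z)%:C.
Proof. by []. Qed.

Lemma cabs_ge0 z : 0 <= cabs z.
Proof. by rewrite -lecR -cabsE normr_ge0. Qed.

Lemma cabsM z w : cabs (z * w) = cabs z * cabs w.
Proof. exact: ComplexField.Normc.normcM. Qed.

Lemma cabsD z w : cabs (z + w) <= cabs z + cabs w.
Proof. by rewrite -lecR rmorphD -!cabsE ler_normD. Qed.

Lemma cabsN z : cabs (- z) = cabs z.
Proof. by apply: complexI; rewrite -!cabsE normrN. Qed.

Lemma cabs0 : cabs (0 : R[i]) = 0.
Proof. exact: ComplexField.Normc.normc0. Qed.

Lemma cabs1 : cabs (1 : R[i]) = 1.
Proof. exact: ComplexField.Normc.normc1. Qed.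

Lemma cabs_real (x : R) : cabs x%:C = `|x|.
Proof. by rewrite /= expr0n addr0 sqrtr_sqr. Qed.

Lemma sqr_cabs z : cabs z ^+ 2 = complex.Re z ^+ 2 + complex.Im z ^+ 2.
Proof. by case: z => a b; rewrite /= sqr_sqrtr// addr_ge0 ?sqr_ge0. Qed.

Lemma cabs_sum (I : Type) (s : seq I) (F : I -> R[i]) :
  cabs (\sum_(i <- s) F i) <= \sum_(i <- s) cabs (F i).
Proof.
elim/big_rec2: _ => [|i x z _ h]; first by rewrite cabs0.
by apply: (le_trans (cabsD _ _)); rewrite lerD2l.
Qed.

Lemma Re_le_cabs z : `|complex.Re z| <= cabs z.
Proof.
case: z => a b /=; rewrite -sqrtr_sqr ler_sqrt ?addr_ge0 ?sqr_ge0//.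
by rewrite lerDl sqr_ge0.
Qed.

Lemma Im_le_cabs z : `|complex.Im z| <= cabs z.
Proof.
case: z => a b /=; rewrite -sqrtr_sqr ler_sqrt ?addr_ge0 ?sqr_ge0//.
by rewrite lerDr sqr_ge0.
Qed.

Lemma cabs_le_ReIm z : cabs z <= `|complex.Re z| + `|complex.Im z|.
Proof.
rewrite {1}[z]complexE; apply: (le_trans (cabsD _ _)).
by rewrite cabsM !cabs_real /= expr0n expr1n add0r sqrtr1 mul1r.
Qed.

Lemma ReB z w : complex.Re (z - w) = complex.Re z - complex.Re w.
Proof. by case: z; case: w. Qed.

Lemma ImB z w : complex.Im (z - w) = complex.Im z - complex.Im w.
Proof. by case: z; case: w. Qed.

End ComplexModulus.

(** * Complex systems and their perturbation *)

(** Real and imaginary parts become separate components indexed by [I * bool]. The weights [k a] are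
    real, so the singular term respects this splitting; the two parts may interact only through [r],
    where just the sum of squares matters. *)
Lemma orbit_gronwall_complex (R : realType) (I : finType) (J : eqType)
    (s : seq J) (k : J -> R) (sigma : J -> I -> I) (u du r : I -> R -> R[i])
    (L H : R) :
  (forall a, a \in s -> 0 <= k a) ->
  (forall a, a \in s -> involutive (sigma a)) ->
  0 <= L -> 0 <= H ->
  (forall i (t : R), 0 <= t <= 1 ->
     is_derive t (1 : R) (fun x : R => complex.Re (u i x)) (complex.Re (du i t)) /\
     is_derive t (1 : R) (fun x : R => complex.Im (u i x)) (complex.Im (du i t))) ->
  (forall i (t : R), 0 < t <= 1 ->
     t%:C * du i t = - (\sum_(a <- s) (k a)%:C * (u i t - u (sigma a i) t))
                     + t%:C * r i t) ->
  (forall t : R, 0 < t <= 1 ->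
     \sum_i cabs (r i t) ^+ 2 <= L * (\sum_i cabs (u i t) ^+ 2) + H) ->
  forall t : R, 0 <= t <= 1 ->
    \sum_i cabs (u i t) ^+ 2 <= (\sum_i cabs (u i 0) ^+ 2 + H) * expR (1 + L).
Proof.
move=> k0 sigmaK L0 H0 hdu ode hr t t01.
pose part (b : bool) := if b then @complex.Re R else @complex.Im R.
pose split_ (f : I -> R -> R[i]) (p : I * bool) (x : R) := part p.2 (f p.1 x).
have sumE (f : I -> R -> R[i]) (x : R) :
    \sum_i cabs (f i x) ^+ 2 = \sum_p split_ f p x ^+ 2.
  rewrite -(pair_bigA _ (fun i b => part b (f i x) ^+ 2)) /=.
  by apply: eq_bigr => i _; rewrite big_bool sqr_cabs.
rewrite !sumE.
apply: (@orbit_gronwall R (I * bool)%type J s k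
  (fun a p => (sigma a p.1, p.2)) (split_ u) (split_ du) (split_ r)) => //.
- by move=> a /sigmaK K [i b] /=; rewrite K.
- by move=> [i b] x /(hdu i) [hRe hIm]; case: b.
- move=> [i b] x x01; have := ode i x x01.
  have partD b' z w : part b' (z + w) = part b' z + part b' w.
    by rewrite /part; case: b'; case: z; case: w.
  have partN b' z : part b' (- z) = - part b' z by rewrite /part; case: b'; case: z.
  have partM b' (y : R) z : part b' (y%:C * z) = y * part b' z.
    by rewrite /part; case: b'; case: z => c d /=; rewrite mul0r ?subr0 ?addr0.
  have part0 b' : part b' 0 = 0 by rewrite /part; case: b'.
  move=> /(congr1 (part b)); rewrite partD !partM partN => e.
  rewrite /split_ /= e; congr (- _ + _).
  rewrite (big_morph _ (partD b) (part0 b)); apply: eq_bigr => a _.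
  by rewrite partM partD partN.
- by move=> x x01; rewrite -!sumE; exact: hr.
Qed.

(** [K] is chosen before the solutions, the coefficients and [eta], which later gives uniformity.
    Gronwall is applied twice: with [H = 0] to bound [u], then to [u - v], which starts at 0 and is
    driven by terms of size [eta]. The factor [t] in front of [psi] cancels the singularity, so this
    correction counts as a bounded perturbation. *)
Lemma orbit_perturbation (R : realType) (I : finType) (J : eqType)
    (s : seq J) (k : J -> R) (sigma : J -> I -> I) (B : R) :
  (forall a, a \in s -> 0 <= k a) ->
  (forall a, a \in s -> involutive (sigma a)) -> 0 <= B ->
  exists2 K : R, 0 <= K &
  forall (u du v dv : I -> R -> R[i]) (b c : I -> R[i])
    (psi : J -> I -> R -> R[i]) (eta : R),
  0 <= eta <= 1 ->
  (forall i, cabs (b i) <= B) -> (forall i, cabs (c i) <= eta * B) ->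
  (forall a i (t : R), a \in s -> 0 < t <= 1 -> cabs (psi a i t) <= eta * B) ->
  (forall i (t : R), 0 <= t <= 1 ->
     is_derive t (1 : R) (fun x : R => complex.Re (u i x)) (complex.Re (du i t)) /\
     is_derive t (1 : R) (fun x : R => complex.Im (u i x)) (complex.Im (du i t))) ->
  (forall i (t : R), 0 <= t <= 1 ->
     is_derive t (1 : R) (fun x : R => complex.Re (v i x)) (complex.Re (dv i t)) /\
     is_derive t (1 : R) (fun x : R => complex.Im (v i x)) (complex.Im (dv i t))) ->
  (forall i (t : R), 0 < t <= 1 ->
     t%:C * du i t = - (\sum_(a <- s) (k a)%:C * ((1 + t%:C * psi a i t) *
                                          (u i t - u (sigma a i) t)))
                     + t%:C * ((b i + c i) * u i t)) ->
  (forall i (t : R), 0 < t <= 1 ->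
     t%:C * dv i t = - (\sum_(a <- s) (k a)%:C * (v i t - v (sigma a i) t))
                     + t%:C * (b i * v i t)) ->
  (forall i, u i 0 = 1) -> (forall i, v i 0 = 1) ->
  forall i, cabs (u i 1 - v i 1) <= eta * K.
Proof.
move=> k0 sigmaK B0.
pose kappa := \sum_(a <- s) k a.
have kappa0 : 0 <= kappa by rewrite /kappa big_seq sumr_ge0.
pose N : R := #|I|%:R.
have N0 : 0 <= N by rewrite ler0n.
(* As [eta <= 1], the factor [2 * B] bounds [b i + c i], and [2 * kappa * B] bounds the [psi] terms
   relative to the square root of the energy. Summing the squares over [I] gives [N]. *)
pose L := N * (2 * B + 2 * kappa * B) ^+ 2.
have L0 : 0 <= L by rewrite mulr_ge0 ?sqr_ge0.
pose X2 := N * expR (1 + L).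
have X20 : 0 <= X2 by rewrite mulr_ge0 ?expR_ge0.
(* For [u - v] the remainder is at most [B] times the root of its energy plus a forcing of order
   [eta]. The factors 2 come from bounding the square of a sum by twice the sum of the squares. *)
pose L' := 2 * N * B ^+ 2.
have L'0 : 0 <= L' by rewrite !mulr_ge0.
pose H' := 2 * N * (B + 2 * kappa * B) ^+ 2 * X2.
have H'0 : 0 <= H' by rewrite !mulr_ge0 ?sqr_ge0// addr_ge0 ?mulr_ge0.
exists (Num.sqrt (H' * expR (1 + L'))); first exact: sqrtr_ge0.
move=> u du v dv b c psi eta /andP[eta0 eta1] hb hc hpsi hdu hdv odeu odev u0 v0.
have le_sqrtV (w : I -> R[i]) j : cabs (w j) <= Num.sqrt (\sum_i cabs (w i) ^+ 2).
  rewrite -[leLHS]ger0_norm ?cabs_ge0// -sqrtr_sqr ler_sqrt.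
    by rewrite (bigD1 j)//= lerDl sumr_ge0// => i _; rewrite sqr_ge0.
  by apply: sumr_ge0 => i _; rewrite sqr_ge0.
have sqrV (w : I -> R[i]) : Num.sqrt (\sum_i cabs (w i) ^+ 2) ^+ 2 =
    \sum_i cabs (w i) ^+ 2.
  by rewrite sqr_sqrtr// sumr_ge0// => i _; rewrite sqr_ge0.
pose V (w : I -> R -> R[i]) t := \sum_i cabs (w i t) ^+ 2.
(* The [psi] part of the singular sum after division by [t]; it moves into the regular remainder. *)
pose q i t := \sum_(a <- s) (k a)%:C * (psi a i t * (u i t - u (sigma a i) t)).
have hq i (t : R) : 0 < t <= 1 ->
    cabs (q i t) <= eta * (2 * kappa * B) * Num.sqrt (V u t).
  move=> t01; apply: (le_trans (cabs_sum _ _)).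
  have -> : eta * (2 * kappa * B) * Num.sqrt (V u t) =
      \sum_(a <- s) k a * (eta * B * (2 * Num.sqrt (V u t))).
    by rewrite -mulr_suml /kappa; ring.
  rewrite big_seq [leRHS]big_seq; apply: ler_sum => a sa.
  rewrite cabsM cabs_real ger0_norm ?k0//; apply: ler_wpM2l; first exact: k0.
  rewrite cabsM; apply: ler_pM; rewrite ?cabs_ge0 ?hpsi//.
  apply: (le_trans (cabsD _ _)); rewrite cabsN [leRHS]mulr_natl mulr2n.
  by apply: lerD; exact: (le_sqrtV (u^~ t)).
have Vu (t : R) : 0 <= t <= 1 -> V u t <= X2.
  move=> t01.
  (* All components start at 1, so the initial energy is [N]. *)
  have -> : X2 = (V u 0 + 0) * expR (1 + L).
    rewrite addr0 /V; under eq_bigr do rewrite u0 cabs1 expr1n.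
    by rewrite sumr_const.
  apply: (@orbit_gronwall_complex R I J s k sigma u du
    (fun i t => (b i + c i) * u i t - q i t)) => //.
    move=> i x x01; rewrite odeu// mulrBr addrCA [RHS]addrC; congr (_ + _).
    rewrite -opprD mulr_sumr -big_split; congr (- _); apply: eq_bigr => a _ /=.
    by ring.
  move=> x x01; rewrite addr0.
  apply: (@le_trans _ _ (\sum_(i : I) ((2 * B + 2 * kappa * B) ^+ 2 * V u x))).
    apply: ler_sum => i _; rewrite -[V u x]sqrV -exprMn.
    rewrite ler_sqr ?nnegrE ?cabs_ge0 ?mulr_ge0 ?sqrtr_ge0 ?addr_ge0 ?mulr_ge0//.
    apply: (le_trans (cabsD _ _)); rewrite cabsN cabsM mulrDl; apply: lerD.
      apply: ler_pM; rewrite ?cabs_ge0//; last exact: (le_sqrtV (u^~ x)).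
      apply: (le_trans (cabsD _ _)); rewrite mulr_natl mulr2n lerD//.
      by apply: (le_trans (hc _)); rewrite ler_piMl.
    apply: (le_trans (hq _ _ x01)); rewrite ler_wpM2r ?sqrtr_ge0//.
    by rewrite ler_piMl// !mulr_ge0.
  by rewrite sumr_const -[leLHS]mulr_natl mulrA.
pose d i t := u i t - v i t.
pose dd i t := du i t - dv i t.
have Vd : V d 1 <= eta ^+ 2 * (H' * expR (1 + L')).
  rewrite mulrA.
  (* The two solutions agree at 0, so the initial energy of the difference vanishes and only the
     forcing remains. *)
  have -> : eta ^+ 2 * H' = V d 0 + eta ^+ 2 * H'.
    rewrite /V /d; under eq_bigr do rewrite u0 v0 subrr cabs0 expr0n.
    by rewrite sumr_const mul0rn add0r.
  apply: (@orbit_gronwall_complex R I J s k sigma d dd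
    (fun i t => b i * d i t + (c i * u i t - q i t))) => //.
  - by rewrite mulr_ge0 ?sqr_ge0.
  - move=> i x x01; have [uR uI] := hdu i x x01; have [vR vI] := hdv i x x01.
    have eR : (fun y => complex.Re (d i y)) =
        (fun y => complex.Re (u i y)) - (fun y => complex.Re (v i y)).
      by apply/funext => y; rewrite /d ReB.
    have eI : (fun y => complex.Im (d i y)) =
        (fun y => complex.Im (u i y)) - (fun y => complex.Im (v i y)).
      by apply/funext => y; rewrite /d ImB.
    split; [rewrite eR|rewrite eI]; apply: is_derive_eq;
      by rewrite /dd ?ReB ?ImB.
  - move=> i x x01; rewrite /dd mulrBr odeu// odev//.
    have -> : \sum_(a <- s) (k a)%:C * (d i x - d (sigma a i) x) =
      \sum_(a <- s) (k a)%:C * (u i x - u (sigma a i) x) -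
      \sum_(a <- s) (k a)%:C * (v i x - v (sigma a i) x).
      by rewrite -sumrB; apply: eq_bigr => a _; rewrite /d; ring.
    have -> : \sum_(a <- s) (k a)%:C * ((1 + x%:C * psi a i x) *
                                          (u i x - u (sigma a i) x)) =
      \sum_(a <- s) (k a)%:C * (u i x - u (sigma a i) x) + x%:C * q i x.
      by rewrite mulr_sumr -big_split; apply: eq_bigr => a _ /=; ring.
    by rewrite /d; ring.
  - move=> x x01.
    have x01' : 0 <= x <= 1 by case/andP: x01 => /ltW-> ->.
    apply: (@le_trans _ _ (\sum_(i : I) (2 * (B ^+ 2 * V d x) +
        2 * (eta ^+ 2 * ((B + 2 * kappa * B) ^+ 2 * X2))))).
      apply: ler_sum => i _; rewrite -[V d x]sqrV.
      set D := Num.sqrt _.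
      have D0 : 0 <= D by rewrite sqrtr_ge0.
      pose Y := eta * ((B + 2 * kappa * B) * Num.sqrt X2).
      have h1 : cabs (b i * d i x) <= B * D.
        by rewrite cabsM ler_pM ?cabs_ge0//; exact: (le_sqrtV (d^~ x)).
      have h2 : cabs (c i * u i x - q i x) <= Y.
        have sV : Num.sqrt (V u x) <= Num.sqrt X2 by rewrite ler_sqrt// Vu.
        apply: (le_trans (cabsD _ _)); rewrite cabsN /Y mulrA mulrDr mulrDl.
        apply: lerD.
          rewrite cabsM ler_pM ?cabs_ge0// (le_trans _ sV)//.
          exact: (le_sqrtV (u^~ x)).
        by apply: (le_trans (hq _ _ x01)); rewrite ler_wpM2l// !mulr_ge0.
      have Y0 : 0 <= Y := le_trans (cabs_ge0 _) h2.
      apply: (@le_trans _ _ ((B * D + Y) ^+ 2)).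
        rewrite ler_sqr ?nnegrE ?cabs_ge0//; last by rewrite addr_ge0// mulr_ge0.
        by apply: (le_trans (cabsD _ _)); rewrite lerD.
      rewrite -[X2]sqr_sqrtr// -!exprMn.
      have := sqr_ge0 (B * D - Y); rewrite -/Y; nra.
    rewrite sumr_const -[leLHS]mulr_natl /L' /H' -/N -/(V d x) le_eqVlt.
    by apply/orP; left; apply/eqP; ring.
  - by rewrite ler01 lexx.
move=> i; apply: (le_trans (le_sqrtV (d^~ 1) i)).
rewrite -[eta]ger0_norm// -sqrtr_sqr -sqrtrM ?sqr_ge0// ler_sqrt//.
by rewrite mulr_ge0 ?sqr_ge0// mulr_ge0 ?expR_ge0.
Qed.

(** * Second-order bounds for the exponential and the Cherednik denominator *)

Section ExpEstimate.
Context {R : realType}.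
Implicit Types x y : R.

Lemma sin_le_norm y : `|sin y| <= `|y|.
Proof.
wlog y0 : y / 0 <= y.
  move=> h; have [|/ltW y0] := leP 0 y; first exact: h.
  by have := h (- y); rewrite sinN !normrN; apply; rewrite oppr_ge0.
have [c _] := @MVT_segment R sin cos 0 y y0
  (fun _ _ => is_derive_sin _) (continuous_subspaceT (@continuous_sin R)).
rewrite sin0 !subr0 => ->; rewrite normrM ler_piMl//.
by rewrite ler_norml cos_geN1 cos_le1.
Qed.

Lemma cosB1_le_sqr y : `|cos y - 1| <= y ^+ 2.
Proof.
wlog y0 : y / 0 <= y.
  move=> h; have [|/ltW y0] := leP 0 y; first exact: h.
  by have := h (- y); rewrite cosN sqrrN; apply; rewrite oppr_ge0.
have [c] := @MVT_segment R cos (fun z => - sin z) 0 y y0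
  (fun _ _ => is_derive_cos _) (continuous_subspaceT (@continuous_cos R)).
rewrite in_itv /= => /andP[c0 cy]; rewrite cos0 subr0 => ->.
rewrite normrM normrN expr2 (ger0_norm y0) ler_wpM2r//.
by apply: (le_trans (sin_le_norm _)); rewrite ger0_norm.
Qed.

(** By the mean value theorem the quotient by [y] is [cos c - 1] with [c < y <= 1], and
    [c ^+ 2 <= y]. *)
Lemma sinB_le_sqr y : `|y| <= 1 -> `|sin y - y| <= y ^+ 2.
Proof.
wlog y0 : y / 0 <= y.
  move=> h; have [|/ltW y0] := leP 0 y; first exact: h.
  have := h (- y); rewrite sinN sqrrN normrN -opprD normrN.
  by apply; rewrite oppr_ge0.
rewrite ger0_norm// => y1.
have d z : is_derive z (1 : R) (fun t => sin t - t) (cos z - 1).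
  by apply: is_derive_eq.
have [c] := @MVT_segment R (fun t => sin t - t) (fun z => cos z - 1) 0 y y0
  (fun z _ => d z) (continuous_subspaceT
    (fun z => differentiable_continuous
      (proj1 (derivable1_diffP _ _) (@ex_derive _ _ _ _ _ _ _ (d z))))).
rewrite in_itv /= => /andP[c0 cy]; rewrite sin0 subrr !subr0 => ->.
rewrite normrM expr2 (ger0_norm y0) ler_wpM2r//.
apply: (le_trans (cosB1_le_sqr _)).
by rewrite expr2; apply: (le_trans _ cy); rewrite ler_piMl// (le_trans cy).
Qed.

(** Both sides follow from [1 + t <= expR t], at [t = x] and at [t = - x]; the latter gives
    [expR x <= 1 / (1 - x)]. *)
Lemma expRB_le_sqr x : `|x| <= 2^-1 -> 0 <= expR x - 1 - x <= 2 * x ^+ 2.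
Proof.
rewrite ler_norml => /andP[h1 h2].
have := expR_ge1Dx x; have := expR_ge1Dx (- x); rewrite expRN => a1 a2.
have e0 := expR_gt0 x.
have x1 : 0 < 1 - x by lra.
have : (1 - x) * expR x <= 1 by rewrite -ler_pdivlMr// mul1r.
by nra.
Qed.

Lemma cexpB_le_sqr (w : R[i]) : cabs w <= 2^-1 ->
  cabs (cexp w - 1 - w) <= 5 * cabs w ^+ 2.
Proof.
move=> w1; have := le_trans (Re_le_cabs w) w1; have := le_trans (Im_le_cabs w) w1.
rewrite sqr_cabs.
have eR : complex.Re (cexp w - 1 - w) = (expR (complex.Re w) - 1 - complex.Re w)
    + expR (complex.Re w) * (cos (complex.Im w) - 1) by rewrite !ReB /=; ring.
have eI : complex.Im (cexp w - 1 - w) = expR (complex.Re w) *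
    (sin (complex.Im w) - complex.Im w) + (expR (complex.Re w) - 1) * complex.Im w.
  by rewrite !ImB /=; ring.
move: (complex.Re w) (complex.Im w) eR eI => x y eR eI hy hx.
have hc := cosB1_le_sqr y; have hs := sinB_le_sqr (le_trans hy _).
have {}hs : `|sin y - y| <= y ^+ 2 by apply: hs; lra.
have := expRB_le_sqr hx => he.
apply: (le_trans (cabs_le_ReIm _)); rewrite eR eI.
have e0 := expR_gt0 x.
have e2 : expR x <= 2.
  by move: hx he; rewrite ler_norml => /andP[? ?] /andP[? ?]; nra.
set A := `|_|; set D := `|_|.
have hA : A <= 2 * x ^+ 2 + 2 * y ^+ 2.
  apply: (le_trans (ler_normD _ _)); apply: lerD.
    by case/andP: he => ? ?; rewrite ger0_norm.
  by rewrite normrM (ger0_norm (ltW e0)) ler_pM.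
have hD : D <= 2 * y ^+ 2 + (x ^+ 2 + y ^+ 2) * 1.
  apply: (le_trans (ler_normD _ _)); apply: lerD.
    by rewrite normrM (ger0_norm (ltW e0)) ler_pM.
  rewrite normrM.
  have : `|expR x - 1| <= 2 * `|x|.
    have x2 : x ^+ 2 = `|x| ^+ 2 by rewrite real_normK ?num_real.
    have -> : expR x - 1 = (expR x - 1 - x) + x by ring.
    apply: (le_trans (ler_normD _ _)); case/andP: he => ? ?.
    by rewrite ger0_norm//; have := normr_ge0 x; nra.
  have -> : x ^+ 2 = `|x| ^+ 2 by rewrite real_normK ?num_real.
  have -> : y ^+ 2 = `|y| ^+ 2 by rewrite real_normK ?num_real.
  have := normr_ge0 x; have := normr_ge0 y.
  by have := sqr_ge0 (`|x| - `|y|); nra.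
(* The bounds add up to [3 * x ^+ 2 + 5 * y ^+ 2], whence the constant 5. *)
by have := sqr_ge0 x; have := sqr_ge0 y; lra.
Qed.

(** The error of [1 - cexp (- s)] against [s] is at most [5 * cabs s ^+ 2], hence at most half of
    [cabs s] in this range. The denominator therefore has modulus at least [cabs s / 2], and
    dividing the error by it gives the factor 10. This is what turns Cherednik operators into Dunkl
    operators in the limit. *)
Lemma cherednik_denominator (s : R[i]) : s != 0 -> cabs s <= 10^-1 ->
  1 - cexp (- s) != 0 /\ cabs (s / (1 - cexp (- s)) - 1) <= 10 * cabs s.
Proof.
move=> s0 hs.
have s1 : 0 < cabs s.
  by rewrite lt_def cabs_ge0 andbT; apply: contra s0 => /eqP /ComplexField.Normc.eq0_normc ->.
have h : cabs (s - (1 - cexp (- s))) <= 5 * cabs s ^+ 2.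
  have -> : s - (1 - cexp (- s)) = cexp (- s) - 1 - (- s) by ring.
  by rewrite -(cabsN s); apply: cexpB_le_sqr; rewrite cabsN; lra.
have low : cabs s / 2 <= cabs (1 - cexp (- s)).
  have := cabsD (s - (1 - cexp (- s))) (1 - cexp (- s)); rewrite subrK.
  by nra.
have d0 : 1 - cexp (- s) != 0.
  by apply/negP => /eqP e; move: low; rewrite e cabs0; lra.
split => //.
have -> : s / (1 - cexp (- s)) - 1 = (s - (1 - cexp (- s))) / (1 - cexp (- s)).
  by rewrite mulrBl divff.
rewrite cabsM ComplexField.Normc.normcV ler_pdivrMr; last by lra.
by nra.
Qed.

End ExpEstimate.

(** * Real inner product and reflections *)

Section RealInnerProduct.
Context {R : realType} {n : nat} (ip : {dot 'rV[R]_n for idfun}).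
Implicit Types x y a : 'rV[R]_n.

Lemma dotC x y : ip x y = ip y x.
Proof. by rewrite (hermC ip) /= expr0 mul1r. Qed.

Lemma dotDr x y z : ip x (y + z) = ip x y + ip x z.
Proof. exact: linearD. Qed.

Lemma dotZr (c : R) x y : ip x (c *: y) = c * ip x y.
Proof. by rewrite linearZ. Qed.

Lemma dotDl x y z : ip (x + y) z = ip x z + ip y z.
Proof. by rewrite dotC dotDr !(dotC z). Qed.

Lemma dotZl (c : R) x y : ip (c *: x) y = c * ip x y.
Proof. by rewrite dotC dotZr (dotC y). Qed.

Lemma dotNl x y : ip (- x) y = - ip x y.
Proof. by rewrite -scaleN1r dotZl mulN1r. Qed.

Lemma dotNr x y : ip x (- y) = - ip x y.
Proof. by rewrite -scaleN1r dotZr mulN1r. Qed.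

Lemma dot0r x : ip x 0 = 0.
Proof. exact: linear0. Qed.

Lemma dot_gt0 x : x != 0 -> 0 < ip x x.
Proof. exact: neq0_dnorm_gt0. Qed.

Lemma reflectionK a : a != 0 -> involutive (reflection ip a).
Proof.
move=> /dot_gt0 a0 x; rewrite {1}/reflection.
have -> : ip (reflection ip a x) a = - ip x a.
  by rewrite /reflection dotDl dotNl dotZl divfK ?gt_eqF//; ring.
by rewrite mulrN mulNr scaleNr opprK /reflection subrK.
Qed.

Lemma dot_reflection a x y : ip (reflection ip a x) y = ip x (reflection ip a y).
Proof.
rewrite /reflection dotDl dotDr dotNl dotNr dotZl dotZr (dotC a y).
by congr (_ - _); ring.
Qed.

End RealInnerProduct.

(** * Coordinate-sum norms and complexified maps *)

Definition l1norm (R : realType) (n : nat) (x : 'rV[R]_n) : R :=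
  \sum_j `|x 0 j|.

(** Takes values in [R], whereas the norm of the [R[i]]-module takes values in [R[i]]; all estimates
    can then be made over [R]. *)
Definition l1normC (R : realType) (n : nat) (z : 'rV[R[i]]_n) : R :=
  \sum_j cabs (z 0 j).

(** The complex-linear extension when [g] is linear. It is stated for arbitrary [g] because Weyl
    group elements are bare functions here. *)
Definition complexify (R : realType) (n : nat) (g : 'rV[R]_n -> 'rV[R]_n)
    (z : 'rV[R[i]]_n) : 'rV[R[i]]_n :=
  \row_j (g (vecRe z) 0 j +i* g (vecIm z) 0 j).

Section L1Norm.
Context {R : realType} {n : nat}.
Implicit Types (x y : 'rV[R]_n) (z w : 'rV[R[i]]_n).

Lemma l1norm_ge0 x : 0 <= l1norm x.
Proof. exact: sumr_ge0. Qed.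

Lemma l1normD x y : l1norm (x + y) <= l1norm x + l1norm y.
Proof.
by rewrite -big_split; apply: ler_sum => j _; rewrite !mxE ler_normD.
Qed.

Lemma l1normZ (c : R) x : l1norm (c *: x) = `|c| * l1norm x.
Proof. by rewrite mulr_sumr; apply: eq_bigr => j _; rewrite !mxE normrM. Qed.

Lemma l1normC_ge0 z : 0 <= l1normC z.
Proof. by apply: sumr_ge0 => j _; exact: cabs_ge0. Qed.

Lemma l1normCD z w : l1normC (z + w) <= l1normC z + l1normC w.
Proof.
by rewrite -big_split; apply: ler_sum => j _; rewrite !mxE cabsD.
Qed.

Lemma l1normCZ (c : R[i]) z : l1normC (c *: z) = cabs c * l1normC z.
Proof. by rewrite mulr_sumr; apply: eq_bigr => j _; rewrite !mxE cabsM. Qed.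

Lemma l1norm_vecRe z : l1norm (vecRe z) <= l1normC z.
Proof. by apply: ler_sum => j _; rewrite !mxE Re_le_cabs. Qed.

Lemma l1norm_vecIm z : l1norm (vecIm z) <= l1normC z.
Proof. by apply: ler_sum => j _; rewrite !mxE Im_le_cabs. Qed.

Lemma vecRe_complexify g z : vecRe (complexify g z) = g (vecRe z).
Proof. by apply/rowP => j; rewrite !mxE. Qed.

Lemma vecIm_complexify g z : vecIm (complexify g z) = g (vecIm z).
Proof. by apply/rowP => j; rewrite !mxE. Qed.

Lemma vecReIm_inj z w : vecRe z = vecRe w -> vecIm z = vecIm w -> z = w.
Proof.
move=> /rowP hR /rowP hI; apply/rowP => j.
by have := hR j; have := hI j; rewrite !mxE; case: (z 0 j) (w 0 j) => a b [c d] /= -> ->.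
Qed.

Lemma complexify_id z : complexify id z = z.
Proof. by apply: vecReIm_inj; rewrite ?vecRe_complexify ?vecIm_complexify. Qed.

Lemma l1normC_complexify g (K : R) z : (forall x, l1norm (g x) <= K * l1norm x) ->
  0 <= K -> l1normC (complexify g z) <= 2 * K * l1normC z.
Proof.
move=> hg K0; apply: (@le_trans _ _ (l1norm (g (vecRe z)) + l1norm (g (vecIm z)))).
  rewrite -big_split; apply: ler_sum => j _.
  by apply: (le_trans (cabs_le_ReIm _)); rewrite mxE.
apply: (le_trans (lerD (hg _) (hg _))); rewrite -mulrDr -mulrA mulrCA.
apply: ler_wpM2l => //; rewrite mulr_natl mulr2n.
by rewrite lerD ?l1norm_vecRe ?l1norm_vecIm.
Qed.

Lemma vecC_Re_Im z : z = vecC (vecRe z) + 'i *: vecC (vecIm z).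
Proof.
by apply/rowP => j; rewrite !mxE [LHS]complexE.
Qed.

Lemma vecRe_vecC x : vecRe (vecC x) = x.
Proof. by apply/rowP => j; rewrite !mxE. Qed.

Lemma vecIm_vecC x : vecIm (vecC x) = 0.
Proof. by apply/rowP => j; rewrite !mxE. Qed.

Lemma vecReD z w : vecRe (z + w) = vecRe z + vecRe w.
Proof. by apply/rowP => j; rewrite !mxE; case: (z 0 j); case: (w 0 j). Qed.

Lemma vecImD z w : vecIm (z + w) = vecIm z + vecIm w.
Proof. by apply/rowP => j; rewrite !mxE; case: (z 0 j); case: (w 0 j). Qed.

Lemma vecReZ (c : R[i]) z :
  vecRe (c *: z) = complex.Re c *: vecRe z - complex.Im c *: vecIm z.
Proof. by apply/rowP => j; rewrite !mxE; case: (z 0 j) => a b; case: c. Qed.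

Lemma vecImZ (c : R[i]) z :
  vecIm (c *: z) = complex.Re c *: vecIm z + complex.Im c *: vecRe z.
Proof.
by apply/rowP => j; rewrite !mxE; case: (z 0 j) => a b; case: c => c d /=.
Qed.

End L1Norm.

(** * The bilinear form and the reflections on the complexification *)

Section ComplexInnerProduct.
Context {R : realType} {n : nat} (ip : {dot 'rV[R]_n for idfun}).
Implicit Types (x y a : 'rV[R]_n) (z w : 'rV[R[i]]_n).

Lemma dot_le_l1norm : exists2 K : R, 0 <= K &
  forall x y, `|ip x y| <= K * l1norm x * l1norm y.
Proof.
(* The sum of the absolute values of the Gram matrix entries. *)
exists (\sum_i \sum_j `|ip 'e_i 'e_j|); first by apply: sumr_ge0 => i _; exact: sumr_ge0.
move=> x y.
have -> : ip x y = \sum_i \sum_j x 0 i * y 0 j * ip 'e_i 'e_j.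
  rewrite {1}[x]row_sum_delta dotC linear_sum; apply: eq_bigr => i _ /=.
  rewrite dotZr dotC {1}[y]row_sum_delta linear_sum mulr_sumr.
  by apply: eq_bigr => j _; rewrite /= dotZr mulrA.
apply: (le_trans (ler_norm_sum _ _ _)); rewrite -mulrA mulr_suml.
apply: ler_sum => i _; apply: (le_trans (ler_norm_sum _ _ _)); rewrite mulr_suml.
apply: ler_sum => j _; rewrite !normrM mulrC ler_wpM2l// ler_pM//.
  by rewrite /l1norm (bigD1 i)//= lerDl sumr_ge0.
by rewrite /l1norm (bigD1 j)//= lerDl sumr_ge0.
Qed.

Lemma ipCC z w : ipC ip z w = ipC ip w z.
Proof.
rewrite /ipC (dotC ip (vecRe z)) (dotC ip (vecIm z)) (dotC ip (vecRe z)).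
by rewrite (dotC ip (vecIm z) (vecRe w)) addrC [X in _ +i* X]addrC; congr (_ +i* _); rewrite addrC.
Qed.

Lemma ipCDr z w w' : ipC ip z (w + w') = ipC ip z w + ipC ip z w'.
Proof.
by apply/eqP; rewrite /ipC vecReD vecImD !dotDr eq_complex /=; apply/andP; split; apply/eqP; ring.
Qed.

Lemma ipCZr (c : R[i]) z w : ipC ip z (c *: w) = c * ipC ip z w.
Proof.
apply/eqP; rewrite /ipC vecReZ vecImZ !dotDr !dotNr !dotZr eq_complex.
by case: c => c d /=; apply/andP; split; apply/eqP; ring.
Qed.

Lemma ipCZl (c : R[i]) z w : ipC ip (c *: z) w = c * ipC ip z w.
Proof. by rewrite ipCC ipCZr ipCC. Qed.

Lemma cabs_ipC : exists2 K : R, 0 <= K &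
  forall z w, cabs (ipC ip z w) <= K * l1normC z * l1normC w.
Proof.
have [K K0 hK] := dot_le_l1norm.
have h x y z w : l1norm x <= l1normC z -> l1norm y <= l1normC w ->
    `|ip x y| <= K * l1normC z * l1normC w.
  move=> hx hy; apply: (le_trans (hK _ _)).
  by rewrite ler_pM ?mulr_ge0 ?l1norm_ge0// ler_wpM2l.
(* The real and imaginary parts of [ipC] together consist of four real products. *)
exists (4 * K) => [|z w]; first by rewrite mulr_ge0.
have hR := @l1norm_vecRe R n; have hI := @l1norm_vecIm R n.
apply: (le_trans (cabs_le_ReIm _)) => /=.
apply: (le_trans (lerD (ler_normD _ _) (ler_normD _ _))); rewrite normrN.
have := h _ _ z w (hR _) (hR _); have := h _ _ z w (hI _) (hI _).
have := h _ _ z w (hR _) (hI _); have := h _ _ z w (hI _) (hR _).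
by rewrite -!mulrA; set X := K * _; lra.
Qed.

Lemma vecRe_reflectionC a z :
  vecRe (reflectionC ip a z) = reflection ip a (vecRe z).
Proof.
rewrite /reflectionC vecReD -scaleNr vecReZ vecRe_vecC vecIm_vecC scaler0 subr0.
rewrite /reflection -scaleNr; congr (_ + _ *: _).
rewrite /ipC vecRe_vecC vecIm_vecC !dot0r subr0 add0r -fmorphV /=; ring.
Qed.

Lemma vecIm_reflectionC a z :
  vecIm (reflectionC ip a z) = reflection ip a (vecIm z).
Proof.
rewrite /reflectionC vecImD -scaleNr vecImZ vecRe_vecC vecIm_vecC scaler0 add0r.
rewrite /reflection -scaleNr; congr (_ + _ *: _).
rewrite /ipC vecRe_vecC vecIm_vecC !dot0r subr0 add0r -fmorphV /=; ring.
Qed.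

(** Reflections permute the orbit of [z] by left composition on the group element; this supplies the
    involutions of the Gronwall argument. *)
Lemma reflectionC_complexify a g z :
  reflectionC ip a (complexify g z) = complexify (reflection ip a \o g) z.
Proof.
apply: vecReIm_inj.
  by rewrite vecRe_reflectionC !vecRe_complexify.
by rewrite vecIm_reflectionC !vecIm_complexify.
Qed.

Lemma reflectionCZ a (c : R[i]) z :
  reflectionC ip a (c *: z) = c *: reflectionC ip a z.
Proof.
by rewrite /reflectionC ipCZl scalerBr scalerA; congr (_ - _ *: _); ring.
Qed.

Lemma reflection_lipschitz a : exists2 K : R, 0 <= K &
  forall x, l1norm (reflection ip a x) <= K * l1norm x.
Proof.
have [K K0 hK] := dot_le_l1norm.
exists (1 + `|2 / ip a a| * K * l1norm a * l1norm a).
  by rewrite addr_ge0// !mulr_ge0// l1norm_ge0.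
move=> x; apply: (le_trans (l1normD _ _)); rewrite [leRHS]mulrDl mul1r lerD2l.
rewrite -scaleNr l1normZ normrN [leRHS]mulrAC ler_wpM2r ?l1norm_ge0//.
have -> : 2 * ip x a / ip a a = 2 / ip a a * ip x a by ring.
rewrite normrM -!mulrA ler_wpM2l//; apply: (le_trans (hK _ _)).
by rewrite -mulrA [l1norm x * _]mulrC.
Qed.

End ComplexInnerProduct.

(** * Weyl group elements: boundedness, action on roots, finiteness *)

Section WeylGroup.
Context {R : realType} {n : nat} (ip : {dot 'rV[R]_n for idfun}).
Context (Rt Rp : {fset 'rV[R]_n}).
Implicit Types (x y a : 'rV[R]_n) (z w : 'rV[R[i]]_n).

Lemma in_weyl_group_lipschitz g : in_weyl_group ip Rt g ->
  exists2 K : R, 0 <= K & forall x, l1norm (g x) <= K * l1norm x.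
Proof.
elim=> [|a h _ _ [K K0 hK]]; first by exists 1 => // x; rewrite mul1r.
have [K' K'0 hK'] := reflection_lipschitz ip a.
exists (K' * K) => [|x]; first exact: mulr_ge0.
by apply: (le_trans (hK' _)); rewrite -mulrA ler_wpM2l.
Qed.

(** The root [b] is the transpose of [g] applied to [a]. It is built one reflection at a time, each
    being self-adjoint and preserving [Rt]. Consequently the orbit of a point off the root
    hyperplanes stays off them. *)
Lemma in_weyl_group_transpose_root g a : root_system ip Rt ->
  in_weyl_group ip Rt g -> a \in Rt ->
  exists2 b, b \in Rt & forall x, ip a (g x) = ip b x.
Proof.
move=> hRt gW; elim: gW a => [|b h bR _ ih] a aR; first by exists a.
have [c cR hc] := ih _ (root_reflection hRt bR aR).
by exists c => // x; rewrite -hc dot_reflection.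
Qed.

Lemma ipC_complexify a b g z : (forall x, ip a (g x) = ip b x) ->
  ipC ip (vecC a) (complexify g z) = ipC ip (vecC b) z.
Proof.
move=> h; rewrite /ipC vecRe_complexify vecIm_complexify !vecRe_vecC !vecIm_vecC.
by rewrite !h (dotC ip 0) (dotC ip 0) (dotC ip 0 (vecIm z)) (dotC ip 0 (vecRe z)) !dot0r.
Qed.

(* An infinite Weyl group would have an empty enumeration, and then the bound
   on C_G would contradict [C_G lambda 0 = 1]. *)
Lemma weyl_group_finite k U C : is_C_G ip Rt Rp k U C ->
  finite_set [set g | in_weyl_group ip Rt g].
Proof.
move=> hC; have := C_G_bound hC 0 (z := 0).
have vecIm0 : vecIm (0 : 'rV[R[i]]_n) = 0 by apply/rowP => j; rewrite !mxE.
rewrite /tube /= vecIm0 => /(_ (C_G_nbhs0 hC)).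
rewrite (C_G_at0 hC) normr1 /weyl_group /fset_set.
case: pselect => // _; rewrite cardfs0 sqrtr0 mul0r lecE /= => /andP[_].
by rewrite ler10.
Qed.

End WeylGroup.

(** * Neighbourhoods, real derivatives along lines, compactness *)

Section Topology.
Context {R : realType}.

Lemma nbhs_l1norm n (x : 'rV[R]_n) (P : set 'rV[R]_n) : nbhs x P ->
  exists2 d : R, 0 < d & forall y, l1norm (y - x) < d -> P y.
Proof.
move=> /nbhs_ballP[d /= d0 h]; exists d => // y hy; apply: h.
split=> [|i j]; first exact: d0.
rewrite /ball /= distrC; apply: le_lt_trans hy.
by rewrite ord1 /l1norm (bigD1 j)//= !mxE lerDl sumr_ge0.
Qed.

Lemma nbhs_l1normC n (z : 'rV[R[i]]_n) (P : set 'rV[R[i]]_n) : nbhs z P ->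
  exists2 d : R, 0 < d & forall w, l1normC (w - z) < d -> P w.
Proof.
move=> /nbhs_ballP[d /= d0 h].
(* The radius lies in [R[i]]; positivity there forces the imaginary part to vanish. *)
move: (d0); rewrite ltcE => /andP[/eqP Imd Red].
have dE : d = (complex.Re d)%:C by case: d Imd {d0 h Red} => a b /= ->.
exists (complex.Re d) => // w hw; apply: h; split=> [|i j]; first exact: d0.
rewrite /ball /= distrC cabsE dE ltcR; apply: le_lt_trans hw.
rewrite ord1 /l1normC (bigD1 j)//= !mxE lerDl sumr_ge0// => l _.
exact: cabs_ge0.
Qed.

Lemma l1normC_near n (z : 'rV[R[i]]_n) (e : R) : 0 < e ->
  nbhs z [set w | l1normC (w - z) < e].
Proof.
(* Dividing by [n.+1] keeps the sum of [n] coordinate errors strictly below [e] and also covers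
   [n = 0]. *)
move=> e0; pose d := e / n.+1%:R.
have d0 : 0 < d by rewrite divr_gt0.
apply/nbhs_ballP; exists d%:C => /=; first by rewrite ltcR.
move=> w [_ hw] /=.
apply: (@le_lt_trans _ _ (\sum_(j < n) d)).
  apply: ler_sum => j _; have := hw 0 j.
  by rewrite /ball /= distrC cabsE ltcR !mxE => /ltW.
rewrite sumr_const card_ord -mulr_natr /d mulrAC ltr_pdivrMr//.
by rewrite ltr_pM2l// ltr_nat.
Qed.

Lemma cabs_continuity n (f : 'rV[R[i]]_n -> R[i]) z (e : R) :
  {for z, continuous f} -> 0 < e ->
  exists2 d : R, 0 < d & forall w, l1normC (w - z) < d -> cabs (f w - f z) < e.
Proof.
move=> /cvgrPdist_lt cf e0.
have eC : 0 < e%:C by rewrite ltcR.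
have [d d0 hd] := nbhs_l1normC (cf _ eC).
by exists d => // w /hd; rewrite /= distrC cabsE ltcR.
Qed.

Lemma real_complex_dnbhs0 : h%:C @[h --> (0 : R)^'] --> (0 : R[i])^'.
Proof.
move=> P /nbhs_ballP[d /= d0 hd].
have d0' : 0 < complex.Re d by move: d0; rewrite ltcE => /andP[].
have dE : d = (complex.Re d)%:C.
  by move: d0; rewrite ltcE => /andP[/eqP]; case: d {hd d0'} => a b /= ->.
apply/nbhs_ballP; exists (complex.Re d) => // h hh h0.
apply: hd; last by rewrite eq_complex /= eqxx andbT.
by move: hh; rewrite /ball /= !sub0r !normrN cabsE dE ltcR cabs_real.
Qed.

(** Real increments [h] are among the complex ones, so the complex difference quotient already
    converges along them. [L] stands for [Re] or [Im]; only real linearity and contractivity are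
    used. *)
Lemma derive_along_line (V : normedModType R[i]) (f : V -> R[i]) (x y : V) (t : R)
    (L : R[i] -> R) :
  (forall z w, L (z - w) = L z - L w) -> (forall (c : R) z, L (c%:C * z) = c * L z) ->
  (forall z, `|L z| <= cabs z) ->
  differentiable f (x + t%:C *: y) ->
  is_derive t (1 : R) (fun s : R => L (f (x + s%:C *: y)))
    (L ('D_y f (x + t%:C *: y))).
Proof.
move=> LB LZ Lle dff; have df : derivable f (x + t%:C *: y) y by exact: diff_derivable.
set F := fun s : R => _; set D := 'D_y f _.
have cF : (fun h : R => h^-1 *: ((F \o shift t) (h *: 1) - F t)) @ 0^' --> L D.
  apply/cvgrPdist_lt => e e0.
  have eC : 0 < e%:C by rewrite ltcR.
  move: df => /cvgrPdist_lt /(_ _ eC) df.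
  have hn : \forall h \near (0 : R)^', `|D - h%:C^-1 *:
      (f (h%:C *: y + (x + t%:C *: y)) - f (x + t%:C *: y))| < e%:C.
    exact: (real_complex_dnbhs0 df).
  apply: filterS hn => h.
  rewrite cabsE ltcR; apply: le_lt_trans.
  have <- : L (D - h%:C^-1 *: (f (h%:C *: y + (x + t%:C *: y)) - f (x + t%:C *: y))) =
      L D - h^-1 *: ((F \o shift t) (h *: 1) - F t).
    rewrite LB -fmorphV /GRing.scale /= LZ LB /F /=; congr (_ - _ * (L (f _) - _)).
    by rewrite rmorphD scalerDl mulr1 addrCA.
  exact: Lle.
apply: DeriveDef; first by apply/cvg_ex; exists (L D).
exact/cvg_lim.
Qed.

Lemma compact_l1normC_bounded n (S : set ('rV[R[i]]_n * 'rV[R[i]]_n)) :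
  compact S ->
  exists2 M : R, 0 <= M & forall p, S p -> l1normC p.1 <= M /\ l1normC p.2 <= M.
Proof.
move=> cS.
pose N (p : 'rV[R[i]]_n * 'rV[R[i]]_n) : R := l1normC p.1 + l1normC p.2.
have cN : continuous N.
  move=> p; apply/cvgrPdist_lt => e e0.
  have e2 : 0 < e / 2 by rewrite divr_gt0.
  exists ([set w | l1normC (w - p.1) < e / 2], [set w | l1normC (w - p.2) < e / 2]).
    by split; exact: l1normC_near.
  move=> [q1 q2] [/= h1 h2].
  have hB (z w : 'rV[R[i]]_n) : `|l1normC z - l1normC w| <= l1normC (w - z).
    have e1 := l1normCD (w - z) z; have e3 := l1normCD (z - w) w.
    have e4 : l1normC (z - w) = l1normC (w - z).
      by rewrite -opprB -scaleN1r l1normCZ cabsN cabs1 mul1r.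
    by rewrite subrK in e1; rewrite subrK e4 in e3; rewrite ler_norml; apply/andP; split; lra.
  have -> : N p - N (q1, q2) = (l1normC p.1 - l1normC q1) + (l1normC p.2 - l1normC q2).
    by rewrite /N /=; ring.
  apply: (le_lt_trans (ler_normD _ _)).
  by have := hB p.1 q1; have := hB p.2 q2; lra.
have cNS : compact (N @` S).
  by apply: continuous_compact => //; exact: continuous_subspaceT.
have [M [_ hM]] := compact_bounded cNS.
have {}hM p : S p -> N p <= `|M| + 1.
  move=> Sp; apply: le_trans (ler_norm _) _.
  by apply: (hM (`|M| + 1)); [rewrite (le_lt_trans (ler_norm _))// ltrDl|exists p].
exists (`|M| + 1) => [|p /hM]; first by rewrite addr_ge0.
have := l1normC_ge0 p.1; have := l1normC_ge0 p.2; rewrite /N => h1 h2 h3.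
by split; lra.
Qed.

(** The induction on [s] shrinks a whole interval [0 < e < d'] free of bad values, of which the
    midpoint is then taken. *)
Lemma avoid_finitely_many (T : eqType) (s : seq T) (bad : T -> R) (d : R) :
  0 < d -> exists2 e : R, 0 < e < d & forall a, a \in s -> e != bad a.
Proof.
move=> d0; suff [d' /andP[d'0 d'd] hd'] : exists2 d' : R, 0 < d' <= d &
    forall e, 0 < e < d' -> forall a, a \in s -> e != bad a.
  have h : 0 < d' / 2 < d' by apply/andP; split; lra.
  by exists (d' / 2) => [|a /(hd' _ h)//]; apply/andP; split; lra.
elim: s => [|a s [d' /andP[d'0 d'd] ih]]; first by exists d; rewrite ?d0 ?lexx.
have [bad0|bad0] := leP (bad a) 0.
  exists d'; first by rewrite d'0.
  move=> e /[dup] he /andP[e0 _] b; rewrite inE => /orP[/eqP ->|]; last exact: ih.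
  by rewrite gt_eqF// (le_lt_trans bad0).
exists (Num.min d' (bad a)); first by rewrite lt_min d'0 bad0 ge_min d'd.
move=> e; rewrite lt_min => /and3P[e0 ed' eb] b; rewrite inE => /orP[/eqP ->|].
  by rewrite lt_eqF.
by apply: ih; rewrite e0.
Qed.

End Topology.

(** * Differentiating the two kernels along rays *)

Section Comparison.
Context {R : realType} {n : nat} (ip : {dot 'rV[R]_n for idfun}).
Context (Rt Rp : {fset 'rV[R]_n}) (k : 'rV[R]_n -> R).
Implicit Types (x y a : 'rV[R]_n) (z w lambda : 'rV[R[i]]_n).

Lemma derive_along_ray (f : 'rV[R[i]]_n -> R[i]) z (t : R) :
  differentiable f (t%:C *: z) ->
  is_derive t (1 : R) (fun s : R => complex.Re (f (s%:C *: z)))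
    (complex.Re ('D_z f (t%:C *: z))) /\
  is_derive t (1 : R) (fun s : R => complex.Im (f (s%:C *: z)))
    (complex.Im ('D_z f (t%:C *: z))).
Proof.
move=> df.
have ray (L : R[i] -> R) : (fun s : R => L (f (s%:C *: z))) =
    (fun s : R => L (f (0 + s%:C *: z))) by apply/funext => s; rewrite add0r.
rewrite (ray (@complex.Re R)) (ray (@complex.Im R)) -[t%:C *: z]add0r in df *.
split; apply: derive_along_line => //.
- exact: ReB.
- by move=> c [a b] /=; rewrite mul0r subr0.
- exact: Re_le_cabs.
- exact: ImB.
- by move=> c [a b] /=; rewrite mul0r addr0.
- exact: Im_le_cabs.
Qed.

Lemma C_G_differentiable U C lambda z : is_C_G ip Rt Rp k U C ->
  tube U z -> differentiable (C lambda) z.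
Proof.
move=> hC Uz.
have h : differentiable (fun p : 'rV[R[i]]_n * 'rV[R[i]]_n => C p.1 p.2) (lambda, z).
  exact: (C_G_holomorphic hC).
have -> : C lambda = (fun p : 'rV[R[i]]_n * 'rV[R[i]]_n => C p.1 p.2) \o
    (fun w => (lambda, w)) by [].
by apply: differentiable_comp => //; apply: differentiable_pair.
Qed.

(** The Dunkl equation is given for real directions, but the rays used here point in complex ones.
    Both sides are complex-linear in [xi], so the real and imaginary directions suffice. *)
Lemma Exp_G_eigen_complex lambda f xi z : is_Exp_G ip Rp k lambda f ->
  (forall a, a \in Rp -> ipC ip (vecC a) z != 0) ->
  dunkl_op ip Rp k xi f z = ipC ip lambda xi * f z.
Proof.
move=> hf hz.
have df : differentiable f z by exact: (Exp_G_holomorphic hf).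
rewrite (vecC_Re_Im xi).
move: (Exp_G_eigen hf (vecRe xi) hz) (Exp_G_eigen hf (vecIm xi) hz).
move: (vecC (vecRe xi)) (vecC (vecIm xi)) => A B.
rewrite /dunkl_op !deriveE// ipCDr ipCZr mulrDl -mulrA => <- <-.
rewrite linearD linearZ mulrDr mulr_sumr [RHS]addrACA -big_split /=.
by congr (_ + _); apply: eq_bigr => a _; rewrite ipCDr ipCZr; ring.
Qed.

End Comparison.

(** * Error bound linear in [cabs eps] on bounded sets *)

Section MainEstimate.
Context {R : realType} {n : nat} (ip : {dot 'rV[R]_n for idfun}).
Context (Rt Rp : {fset 'rV[R]_n}) (k : 'rV[R]_n -> R).
Context (U : set 'rV[R]_n) (C_G Exp_G : 'rV[R[i]]_n -> 'rV[R[i]]_n -> R[i]).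
Context (hRt : root_system ip Rt).
Context (hRp : forall a, a \in Rp -> a \in Rt).
Context (hk0 : forall a, a \in Rt -> 0 <= k a).
Context (hC : is_C_G ip Rt Rp k U C_G).
Context (hE : forall lambda, is_Exp_G ip Rp k lambda (Exp_G lambda)).
Implicit Types (x y a : 'rV[R]_n) (z w lambda : 'rV[R[i]]_n).

(** Here [s] is the value of a root on the ray direction and [t%:C * s] its value at the current
    point. The right-hand side has the shape [1 + t * psi] required by [orbit_perturbation]. *)
Lemma cherednik_reflection_term (t : R) (s D : R[i]) (kap : R) :
  t != 0 -> 1 - cexp (- (t%:C * s)) != 0 ->
  t%:C * (kap%:C * s * (D / (1 - cexp (- (t%:C * s))))) =
  kap%:C * ((1 + t%:C * (t%:C^-1 * (t%:C * s / (1 - cexp (- (t%:C * s))) - 1))) * D).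
Proof.
move=> t0; set den := 1 - _ => den0.
have tC : t%:C != 0 by rewrite eq_complex /= eqxx andbT.
by field; rewrite tC den0.
Qed.

Lemma regular_estimate (M : R) : 0 <= M ->
  exists2 K : R, 0 <= K & exists2 e0 : R, 0 < e0 &
  forall (eps : R[i]) lambda z, eps != 0 -> cabs eps < e0 ->
    l1normC lambda <= M -> l1normC z <= M ->
    (forall a, a \in Rt -> ipC ip (vecC a) z != 0) ->
    cabs (C_G (eps^-1 *: lambda) (eps *: z) - Exp_G lambda z) <= cabs eps * K.
Proof.
move=> M0.
have finW := weyl_group_finite hC.
pose W := weyl_group ip Rt.
have WP g : (g \in W) <-> in_weyl_group ip Rt g.
  by rewrite /W /weyl_group in_fset_set// inE.
have [KW KW0 hKW] : exists2 K : R, 0 <= K &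
    forall (g : W) x, l1norm (val g x) <= K * l1norm x.
  (* One Lipschitz constant per group element; their finite sum serves for all. *)
  have /choice[KW hKW] : forall g : W, exists K : R, 0 <= K /\
      forall x, l1norm (val g x) <= K * l1norm x.
    move=> g; have /WP/in_weyl_group_lipschitz[K K0 hK] := valP g.
    by exists K.
  exists (\sum_g KW g); first by apply: sumr_ge0 => g _; case: (hKW g).
  move=> g x; apply: (le_trans ((hKW g).2 x)); rewrite ler_wpM2r ?l1norm_ge0//.
  by rewrite (bigD1 g)//= lerDl sumr_ge0// => h _; case: (hKW h).
have [Ki Ki0 hKi] := cabs_ipC ip.
have [r r0 hr] := nbhs_l1norm (open_nbhs_nbhs (conj (C_G_open hC) (C_G_nbhs0 hC))).
(* [Y] bounds the orbit points, [A] the roots on them, [b1] the eigenvalues and [b2] the [rho]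
   terms. The 10 in [B] is the factor from [cherednik_denominator]. *)
pose Y := 2 * KW * M.
have Y0 : 0 <= Y by rewrite !mulr_ge0.
pose A := \sum_(a <- Rp) Ki * l1normC (vecC a) * Y.
have A0 : 0 <= A by apply: sumr_ge0 => a _; rewrite !mulr_ge0 ?l1normC_ge0.
pose b1 := Ki * M * Y.
have b10 : 0 <= b1 by rewrite !mulr_ge0.
pose b2 := Ki * l1normC (vecC (rho Rp k)) * Y.
have b20 : 0 <= b2 by rewrite !mulr_ge0 ?l1normC_ge0.
pose B := b1 + b2 + 10 * A.
have A10 : 0 <= 10 * A by exact: mulr_ge0.
have B0 : 0 <= B by apply: addr_ge0 => //; exact: addr_ge0.
(* The default value [g] of [insubd] is never taken for [a] in [Rp], as [sigmaE] shows. *)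
pose sigma a (g : W) : W := insubd g (reflection ip a \o val g).
have sigmaE a g : a \in Rp -> val (sigma a g) = reflection ip a \o val g.
  move=> aP; rewrite /sigma val_insubd ifT//; apply/WP; apply: weyl_reflection.
    exact: hRp.
  exact/WP/valP.
have sigmaK a : a \in Rp -> involutive (sigma a).
  move=> aP g; apply: val_inj; rewrite !sigmaE//; apply/funext => x /=.
  rewrite reflectionK//; apply: contraNneq (root_neq0 hRt) => <-; exact: hRp.
have [K K0 hK] := @orbit_perturbation R W _ (enum_fset Rp) k sigma B
  (fun a aP => hk0 (hRp aP)) sigmaK B0.
(* The three bounds on [cabs eps] ensure [eta <= 1], arguments of modulus at most [10^-1] in
   [cherednik_denominator], and a scaled orbit inside the tube. The added 1 avoids division by
   zero. *)
pose e0 := Num.min 1 (Num.min (B + 1)^-1 (r / (Y + 1))).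
have B1 : 0 < B + 1 by lra.
have Y1 : 0 < Y + 1 by lra.
have e0_gt0 : 0 < e0.
  rewrite !lt_min ltr01 invr_gt0 B1 /=.
  exact: divr_gt0.
exists K => //; exists e0 => // eps lambda z eps0.
rewrite !lt_min => /and3P[/ltW eps1 epsB epsr] lM zM hz.
have eta0 := cabs_ge0 eps.
have {epsB} epsB : cabs eps * B <= 1.
  by move: epsB; rewrite -div1r ltr_pdivlMr//; lra.
have {epsr} epsr : cabs eps * Y < r.
  by move: epsr; rewrite ltr_pdivlMr//; lra.
pose y (g : W) := complexify (val g) z.
have hy g : l1normC (y g) <= Y.
  apply: (le_trans (l1normC_complexify _ (hKW g) KW0)).
  by rewrite ler_wpM2l ?mulr_ge0.
have hyU g (t : R) : 0 <= t <= 1 -> tube U (t%:C *: (eps *: y g)).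
  move=> /andP[t0 t1]; apply: hr; rewrite subr0.
  apply: le_lt_trans (l1norm_vecIm _) _; rewrite !l1normCZ cabs_real ger0_norm//.
  apply: le_lt_trans epsr; apply: (@le_trans _ _ (cabs eps * l1normC (y g))).
    by rewrite ler_piMl// mulr_ge0 ?l1normC_ge0.
  by rewrite ler_wpM2l.
have yrefl a g (t : R) : a \in Rp ->
    reflectionC ip a (t%:C *: (eps *: y g)) = t%:C *: (eps *: y (sigma a g)).
  by move=> aP; rewrite !reflectionCZ /y reflectionC_complexify sigmaE.
have yrefl' a g (t : R) : a \in Rp ->
    reflectionC ip a (t%:C *: y g) = t%:C *: y (sigma a g).
  by move=> aP; rewrite !reflectionCZ /y reflectionC_complexify sigmaE.
have yreg a g : a \in Rp -> ipC ip (vecC a) (y g) != 0.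
  move=> aP; have /WP gW := valP g.
  have [b bR hb] := in_weyl_group_transpose_root hRt gW (hRp aP).
  by rewrite (ipC_complexify _ hb) hz.
have hA a g : a \in Rp -> cabs (ipC ip (vecC a) (y g)) <= A.
  move=> aP; apply: (le_trans (hKi _ _)).
  apply: (@le_trans _ _ (Ki * l1normC (vecC a) * Y)).
    by rewrite ler_wpM2l ?mulr_ge0 ?l1normC_ge0.
  by rewrite /A (big_rem a)//= lerDl sumr_ge0// => c _; rewrite !mulr_ge0 ?l1normC_ge0.
pose den a g (t : R) := 1 - cexp (- (t%:C * ipC ip (vecC a) (eps *: y g))).
pose psi a g (t : R) := t%:C^-1 *
  (t%:C * ipC ip (vecC a) (eps *: y g) / den a g t - 1).
have hden a g (t : R) : a \in Rp -> 0 < t <= 1 ->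
    den a g t != 0 /\ cabs (psi a g t) <= cabs eps * B.
  move=> aP /andP[t0 t1].
  have tC : t%:C != 0 by rewrite eq_complex /= eqxx andbT gt_eqF.
  have s0 : t%:C * ipC ip (vecC a) (eps *: y g) != 0.
    by rewrite ipCZr !mulf_neq0 ?yreg.
  have sA : cabs (t%:C * ipC ip (vecC a) (eps *: y g)) <= t * (cabs eps * A).
    rewrite ipCZr !cabsM cabs_real gtr0_norm// ler_pM2l// ler_wpM2l// hA//.
  have AB : 10 * A <= B by rewrite lerDr addr_ge0.
  have s1 : cabs (t%:C * ipC ip (vecC a) (eps *: y g)) <= 10^-1.
    have : cabs eps * (10 * A) <= 1 by apply: le_trans epsB; rewrite ler_wpM2l.
    have := mulr_ge0 eta0 A0; nra.
  have [d0 hd] := cherednik_denominator s0 s1.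
  split => //; rewrite /psi cabsM -fmorphV cabs_real ger0_norm ?invr_ge0 ?(ltW t0)//.
  rewrite mulrC ler_pdivrMr//; apply: (le_trans hd).
  apply: (@le_trans _ _ (10 * (t * (cabs eps * A)))); first by rewrite ler_wpM2l.
  have -> : 10 * (t * (cabs eps * A)) = t * (cabs eps * (10 * A)) by ring.
  by rewrite [leRHS]mulrC ler_wpM2l ?(ltW t0)// ler_wpM2l.
have idW : id \in W by apply/WP; exact: weyl_id.
(* The point [z] is the orbit point of the identity, and the scalings by 1 below exhibit both
   kernels at time [t = 1]. *)
have -> : z = y [` idW]%fset by rewrite /y /= complexify_id.
rewrite -[eps *: _]scale1r -[X in Exp_G _ X]scale1r.
apply: (hK
  (fun g (t : R) => C_G (eps^-1 *: lambda) (t%:C *: (eps *: y g)))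
  (fun g (t : R) => 'D_(eps *: y g) (C_G (eps^-1 *: lambda)) (t%:C *: (eps *: y g)))
  (fun g (t : R) => Exp_G lambda (t%:C *: y g))
  (fun g (t : R) => 'D_(y g) (Exp_G lambda) (t%:C *: y g))
  (fun g => ipC ip lambda (y g))
  (fun g => ipC ip (vecC (rho Rp k)) (eps *: y g)) psi (cabs eps)).
- by rewrite eta0.
- move=> g; apply: (le_trans (hKi _ _)); apply: (@le_trans _ _ b1).
    by rewrite ler_pM ?mulr_ge0 ?l1normC_ge0// ler_wpM2l.
  by rewrite /B -addrA lerDl addr_ge0.
- move=> g; rewrite ipCZr cabsM ler_wpM2l//.
  apply: (le_trans (hKi _ _)); apply: (@le_trans _ _ b2).
    by rewrite ler_wpM2l ?mulr_ge0 ?l1normC_ge0.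
  by rewrite /B addrAC lerDr addr_ge0.
- by move=> a g t aP t01; case: (hden a g t aP t01).
- move=> g t t01; apply: derive_along_ray.
  exact: C_G_differentiable hC (hyU g t t01).
- move=> g t t01; apply: derive_along_ray.
  exact: (Exp_G_holomorphic (hE lambda)).
- move=> g t /[dup] t01 /andP[t0 t1].
  have t01' : 0 <= t <= 1 by rewrite t1 ltW.
  have tC : t%:C != 0 by rewrite eq_complex /= eqxx andbT gt_eqF.
  have hrefl a : a \in Rp -> tube U (reflectionC ip a (t%:C *: (eps *: y g))).
    by move=> aP; rewrite yrefl//; exact: hyU.
  have hne a : a \in Rp -> 1 - cexp (- ipC ip (vecC a) (t%:C *: (eps *: y g))) != 0.
    by move=> aP; rewrite ipCZr; have [] := hden a g t aP t01.
  have := C_G_eigen hC (eps^-1 *: lambda) (eps *: y g) (hyU g t t01') hrefl hne.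
  (* The two scalings cancel in the eigenvalue, so both systems share the coefficient [b]; the [rho]
     term keeps a factor [eps] and goes into [c]. *)
  have -> : ipC ip (eps^-1 *: lambda) (eps *: y g) = ipC ip lambda (y g).
    by rewrite ipCZl ipCZr mulKf.
  rewrite /cherednik_op => /(canRL (subrK _)) /(canRL (addrK _)) ->.
  rewrite mulrBr addrC mulr_sumr -mulrDl; congr (- _ + _).
  rewrite big_seq [RHS]big_seq; apply: eq_bigr => a aP.
  rewrite yrefl// (ipCZr ip t%:C); apply: cherednik_reflection_term => //.
  - by rewrite gt_eqF.
  - by have [] := hden a g t aP t01.
- move=> g t /[dup] t01 /andP[t0 t1].
  have tC : t%:C != 0 by rewrite eq_complex /= eqxx andbT gt_eqF.
  have hne a : a \in Rp -> ipC ip (vecC a) (t%:C *: y g) != 0.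
    by move=> aP; rewrite ipCZr mulf_neq0 ?yreg.
  have := Exp_G_eigen_complex (y g) (hE lambda) hne; rewrite /dunkl_op => /(canRL (addrK _)) ->.
  rewrite mulrBr addrC mulr_sumr; congr (- _ + _).
  rewrite big_seq [RHS]big_seq; apply: eq_bigr => a aP.
  rewrite yrefl'// ipCZr; field.
  by rewrite tC yreg.
- by move=> g; rewrite scale0r (C_G_at0 hC).
- by move=> g; rewrite scale0r (Exp_G_at0 (hE lambda)).
Qed.

Context (v : 'rV[R]_n).
Context (hv : forall a, a \in Rt -> ip a v != 0).

(** Moving along [v], which is orthogonal to no root, the real part of each [ipC ip (vecC a)] is a
    nonconstant affine function of the real step and vanishes for a single value, to be avoided. *)
Lemma regular_perturbation z (d : R) : 0 < d ->
  exists2 w, l1normC (w - z) < d & forall a, a \in Rt -> ipC ip (vecC a) w != 0.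
Proof.
move=> d0; pose m := l1normC (vecC v) + 1.
have m0 : 0 < m by rewrite ltr_wpDl// l1normC_ge0.
have [e /andP[e0 ed] he] := avoid_finitely_many (enum_fset Rt)
  (fun a => - complex.Re (ipC ip (vecC a) z) / ip a v) (divr_gt0 d0 m0).
exists (z + e%:C *: vecC v).
  rewrite addrC addKr l1normCZ cabs_real gtr0_norm//.
  by move: ed; rewrite ltr_pdivlMr// /m; nra.
move=> a aR; have := he a aR; apply: contraNneq.
rewrite ipCDr ipCZr => /(congr1 (@complex.Re R)).
rewrite [ipC ip (vecC a) (vecC v)]/ipC !vecRe_vecC !vecIm_vecC !dot0r.
have -> (c : R[i]) (b b' : R) : complex.Re (c + e%:C * ((b - 0) +i* b')) =
    complex.Re c + e * b by case: c => ? ? /=; ring.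
by move=> h; apply/eqP/(mulIf (hv aR)); rewrite divfK ?hv//; lra.
Qed.

(** Regular points are dense and both kernels are continuous in [z], so the bound at regular points
    passes to all points with the same [K]. The regular estimate is taken for [M + 1] to leave room
    for the perturbed point. *)
Lemma uniform_estimate (M : R) : 0 <= M ->
  exists2 K : R, 0 <= K & exists2 e0 : R, 0 < e0 &
  forall (eps : R[i]) lambda z, eps != 0 -> cabs eps < e0 ->
    l1normC lambda <= M -> l1normC z <= M ->
    tube U (eps *: z) /\
    cabs (C_G (eps^-1 *: lambda) (eps *: z) - Exp_G lambda z) <= cabs eps * K.
Proof.
move=> M0; have M10 : 0 <= M + 1 by rewrite addr_ge0.
have [K K0 [e0 e0_gt0 hK]] := regular_estimate M10.
have [r r0 hr] := nbhs_l1norm (open_nbhs_nbhs (conj (C_G_open hC) (C_G_nbhs0 hC))).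
exists K => //; exists (Num.min e0 (r / (M + 1))).
  by rewrite lt_min e0_gt0 divr_gt0// ltr_wpDl.
move=> eps lambda z eps0; rewrite lt_min => /andP[epse epsr] lM zM.
have tz : tube U (eps *: z).
  apply: hr; rewrite subr0; apply: le_lt_trans (l1norm_vecIm _) _.
  rewrite l1normCZ; move: epsr; rewrite ltr_pdivlMr ?ltr_wpDl//.
  by apply: le_lt_trans; rewrite ler_wpM2l ?cabs_ge0//; lra.
split => //; rewrite leNgt; apply/negP => hlt.
pose gap := cabs (C_G (eps^-1 *: lambda) (eps *: z) - Exp_G lambda z) - cabs eps * K.
have gap0 : 0 < gap / 2 by rewrite divr_gt0// subr_gt0.
have ae : 0 < cabs eps.
  by rewrite lt_def cabs_ge0 andbT; apply: contra eps0 => /eqP /ComplexField.Normc.eq0_normc ->.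
have cC : {for eps *: z, continuous (C_G (eps^-1 *: lambda))}.
  exact/differentiable_continuous/(C_G_differentiable _ hC tz).
have cE : {for z, continuous (Exp_G lambda)}.
  exact/differentiable_continuous/(Exp_G_holomorphic (hE lambda)).
have [d1 d10 hd1] := cabs_continuity cC gap0.
have [d2 d20 hd2] := cabs_continuity cE gap0.
(* The 1 keeps [w] within [M + 1]; [d1] is divided by [cabs eps] because [C_G] is evaluated at
   [eps *: w]; [d2] controls [Exp_G]. *)
have d0 : 0 < Num.min 1 (Num.min (d1 / cabs eps) d2).
  by rewrite !lt_min ltr01 d20 divr_gt0.
have [w + wreg] := regular_perturbation z d0.
rewrite !lt_min => /and3P[w1 wd1 wd2].
have wM : l1normC w <= M + 1.
  by have := l1normCD (w - z) z; rewrite subrK; lra.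
have lM1 : l1normC lambda <= M + 1 by lra.
have h := hK _ _ _ eps0 epse lM1 wM wreg.
have h1 : cabs (C_G (eps^-1 *: lambda) (eps *: w) - C_G (eps^-1 *: lambda) (eps *: z))
    < gap / 2.
  by apply: hd1; rewrite -scalerBr l1normCZ mulrC -ltr_pdivlMr.
have h2 := hd2 _ wd2.
suff : cabs (C_G (eps^-1 *: lambda) (eps *: z) - Exp_G lambda z) < cabs eps * K + gap.
  by rewrite /gap; lra.
have -> : C_G (eps^-1 *: lambda) (eps *: z) - Exp_G lambda z =
  (C_G (eps^-1 *: lambda) (eps *: w) - Exp_G lambda w)
  + ((Exp_G lambda w - Exp_G lambda z) -
     (C_G (eps^-1 *: lambda) (eps *: w) - C_G (eps^-1 *: lambda) (eps *: z))) by ring.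
apply: (le_lt_trans (cabsD _ _)); apply: ler_ltD => //.
by apply: (le_lt_trans (cabsD _ _)); rewrite cabsN; lra.
Qed.

End MainEstimate.

(** * Uniform convergence on compact sets *)

Theorem theorem4p13 (R : realType) (n : nat) (ip : {dot 'rV[R]_n for idfun})
    (Rt Rp : {fset 'rV[R]_n})
    (hRt : root_system ip Rt) (hRp : positive_system ip Rt Rp)
    (k : 'rV[R]_n -> R) (hk : multiplicity_function ip Rt k)
    (hk0 : forall a, a \in Rt -> 0 <= k a)
    (U : set 'rV[R]_n) (C_G : 'rV[R[i]]_n -> 'rV[R[i]]_n -> R[i])
    (hC : is_C_G ip Rt Rp k U C_G)
    (Exp_G : 'rV[R[i]]_n -> 'rV[R[i]]_n -> R[i])
    (hE : forall lambda, is_Exp_G ip Rp k lambda (Exp_G lambda))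
    (S : set ('rV[R[i]]_n * 'rV[R[i]]_n))
    (hS0 : S !=set0) (hS : compact S) :
  (\forall eps \near (0 : R[i])^', forall p, S p -> tube U (eps *: p.2)) /\
  {uniform S, (fun (eps : R[i]) (p : 'rV[R[i]]_n * 'rV[R[i]]_n) =>
                 C_G (eps^-1 *: p.1) (eps *: p.2)) @ (0 : R[i])^'
     --> (fun p : 'rV[R[i]]_n * 'rV[R[i]]_n => Exp_G p.1 p.2)}.

Proof.
have [v [hv hvp]] := hRp.
have RpRt a : a \in Rp -> a \in Rt by rewrite hvp => /andP[].
have [M M0 hM] := compact_l1normC_bounded hS.
have [K K0 [e0 e0_gt0 hK]] := uniform_estimate hRt RpRt hk0 hC hE hv M0.
have small (e : R) : 0 < e -> \forall eps \near (0 : R[i])^', eps != 0 /\ cabs eps < e.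
  move=> e_gt0; apply/nbhs_ballP; exists e%:C => /=; first by rewrite ltcR.
  by move=> eps; rewrite /ball /= sub0r normrN cabsE ltcR.
split.
  apply: filterS (small _ e0_gt0) => eps [eps0 epse] p /hM[h1 h2].
  by have [] := hK eps p.1 p.2 eps0 epse h1 h2.
move=> P /uniform_nbhs[E [entE hP]].
move: entE; rewrite -entourage_ballE => -[e /= e_gt0 hE'].
have [eR eE] : 0 < complex.Re e /\ e = (complex.Re e)%:C.
  by move: e_gt0; rewrite ltcE => /andP[/eqP]; case: e {hE'} => a b /= ->.
have K1 : 0 < K + 1 by rewrite ltr_wpDl.
(* With this bound [cabs eps * K] is strictly below the radius [complex.Re e]; using [K + 1] covers
   the case [K = 0]. *)
have m0 : 0 < Num.min e0 (complex.Re e / (K + 1)) by rewrite lt_min e0_gt0 divr_gt0.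
have := small _ m0; apply: filterS => eps [eps0]; rewrite lt_min => /andP[epse epsK].
apply: hP => p Sp; apply: hE' => /=.
have [h1 h2] := hM p Sp.
have [_ h] := hK eps p.1 p.2 eps0 epse h1 h2.
rewrite /ball /= distrC cabsE eE ltcR; apply: le_lt_trans h _.
by move: epsK; rewrite ltr_pdivlMr//; have := cabs_ge0 eps; nra.
Qed.
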